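(* For every integer $\alpha\ge 1$, as congruences between formal power series in $q$ with integer coefficients (coefficientwise), \[ \sum_{n\ge0}\overline{p}_3(3^{2\alpha}n)(-q)^n\equiv \frac{\varphi(q^3)^4}{\varphi(q)^7}\pmod{9\cdot 2^3}, \qquad \sum_{n\ge0}\overline{p}_3(3^{2\alpha+1}n)(-q)^n\equiv \frac{\varphi(q^3)^5}{\varphi(q)^8}\pmod{9\cdot 2^3}. \]
   Context: $\overline{p}_3(n)$ denotes the number of overpartition triples of $n$ (triples of overpartitions whose parts together sum to $n$, where an overpartition is a partition in which the first occurrence of each distinct part may be overlined), with $\overline{p}_3(0)=1$; equivalently $\sum_{n\ge0}\overline{p}_3(n)q^n=1/\varphi(-q)^3$, where $\varphi(q)=\sum_{n=-\infty}^{\infty}q^{n^2}$. *)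

(* Defs.v *)
From mathcomp Require Import all_boot all_order all_algebra.

Set Implicit Arguments.
Unset Strict Implicit.
Unset Printing Implicit Defensive.

Import GRing.Theory.

(* An overpartition is a list of pairs (part, overlined?) with positive,
   weakly decreasing parts.  Only the first occurrence of a part may be
   overlined: an entry repeating the previous part must not be. *)
Definition overpart_next (x y : nat * bool) : bool :=
  (y.1 < x.1)%N || ((y.1 == x.1) && ~~ y.2).

Definition is_overpartition (s : seq (nat * bool)) : bool :=
  sorted overpart_next s && all (fun x => 0 < x.1)%N s.

Definition weight (s : seq (nat * bool)) : nat := sumn [seq x.1 | x <- s].

(* Overpartitions of weight at most n have at most n parts, all at most n, so
   they all lie in the following finite type (see [overpart_code_complete]). *)
Definition overpart_code (n : nat) := n.-bseq ('I_n.+1 * bool)%type.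

Definition overpart_decode (n : nat) (b : overpart_code n) : seq (nat * bool) :=
  [seq (nat_of_ord x.1, x.2) | x <- b].

Lemma overpart_decode_inj n : injective (@overpart_decode n).
Proof.
move=> b c bc; apply/val_inj; apply: inj_map bc => -[i u] [j v] /= [ij ->].
by rewrite (val_inj ij).
Qed.

Lemma overpart_code_complete (n : nat) (s : seq (nat * bool)) :
  is_overpartition s -> (weight s <= n)%N ->
  exists b : overpart_code n, overpart_decode b = s.
Proof.
case/andP=> _ pos wn.
have szw : (size s <= weight s)%N.
  elim: s pos {wn} => // x s IH /= /andP[x0 /IH]; rewrite /weight /= => h.
  by rewrite -add1n leq_add.
have bnd x : x \in s -> (x.1 <= n)%N.
  move=> xs; apply: leq_trans wn.
  elim: s xs {pos szw} => // y s IH; rewrite inE /weight /= => /orP[/eqP->|/IH h].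
    exact: leq_addr.
  exact: leq_trans h (leq_addl _ _).
pose c := [seq (inord x.1 : 'I_n.+1, x.2) | x <- s].
have szc : (size c <= n)%N by rewrite size_map (leq_trans szw).
exists (Bseq szc); rewrite /overpart_decode /= /c -map_comp.
rewrite -[RHS]map_id; apply/eq_in_map => -[k u] /bnd /= kn.
by rewrite inordK.
Qed.

Definition overpartition_triples (n : nat) :
    {set overpart_code n * overpart_code n * overpart_code n} :=
  [set t | [&& is_overpartition (overpart_decode t.1.1),
               is_overpartition (overpart_decode t.1.2),
               is_overpartition (overpart_decode t.2) &
               (weight (overpart_decode t.1.1) + weight (overpart_decode t.1.2)
                + weight (overpart_decode t.2) == n)%N]].

Definition pbar3 (n : nat) : nat := #|overpartition_triples n|.

Local Open Scope ring_scope.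

(* A formal power series is represented by its coefficient sequence. *)
Definition fps (R : Type) := nat -> R.

Section FormalPowerSeries.

Variable R : comUnitRingType.
Implicit Types f g : fps R.

Definition fps_one : fps R := fun n => (n == 0%N)%:R.

Definition fps_mul f g : fps R := fun n => \sum_(i < n.+1) f i * g (n - i)%N.

Definition fps_exp f (k : nat) : fps R := iter k (fps_mul f) fps_one.

(* The first n + 1 coefficients of 1 / f, obtained by solving f * g = 1 degree
   by degree; meaningful when the constant term of f is a unit. *)
Fixpoint fps_inv_seq f (n : nat) : seq R :=
  if n is m.+1 then
    let s := fps_inv_seq f m in
    rcons s (- (f 0%N)^-1 * \sum_(i < m.+1) f (m.+1 - i)%N * s`_i)
  else [:: (f 0%N)^-1].

Definition fps_inv f : fps R := fun n => (fps_inv_seq f n)`_n.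

Definition fps_div f g : fps R := fps_mul f (fps_inv g).

(* f(q) |-> f(q^d), for d > 0 *)
Definition fps_subst_pow (d : nat) f : fps R :=
  fun n => if (d %| n)%N then f (n %/ d)%N else 0.

(* f(q) |-> f(-q) *)
Definition fps_subst_opp f : fps R := fun n => (-1) ^+ n * f n.

Lemma size_fps_inv_seq f n : size (fps_inv_seq f n) = n.+1.
Proof. by elim: n => //= n IH; rewrite size_rcons IH. Qed.

Lemma nth_fps_inv_seq f n i : (i <= n)%N -> (fps_inv_seq f n)`_i = fps_inv f i.
Proof.
elim: n => [|n IH]; first by rewrite leqn0 => /eqP->.
rewrite leq_eqVlt => /orP[/eqP-> //|lt_in].
by rewrite /= nth_rcons size_fps_inv_seq lt_in IH.
Qed.

Lemma fps_mul_inv f : f 0%N \is a GRing.unit -> fps_mul f (fps_inv f) =1 fps_one.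
Proof.
move=> f0 [|n]; first by rewrite /fps_mul big_ord1 /fps_inv /= mulrV.
rewrite /fps_mul big_ord_recl subn0 /=.
rewrite {1}/fps_inv /= nth_rcons size_fps_inv_seq ltnn eqxx.
rewrite mulrA mulrN mulrV // mulN1r /fps_one /=.
rewrite [X in _ + X](reindex_inj rev_ord_inj) -sumrN -big_split big1 //= => i _.
have le_in : (i <= n)%N by rewrite -ltnS.
rewrite nth_fps_inv_seq // /bump /= add1n !subSS subKn // -subSn //.
by rewrite addNr.
Qed.

End FormalPowerSeries.

Definition fps_eqmod (m : int) (f g : fps int) : Prop :=
  forall n : nat, (f n = g n %[mod m])%Z.

(* phi(q) = sum over all integers k of q^(k^2); the integers k with k^2 = n
   satisfy |k| <= n, and are enumerated as k = i - n with 0 <= i <= 2n. *)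
Definition phi : fps int :=
  fun n => (#|[set i : 'I_n.*2.+1 | (i%:Z - n%:Z) ^+ 2 == n%:Z]|)%:Z.

Lemma phi0 : phi 0 = 1.
Proof.
rewrite /phi (_ : [set i | _] = [set ord0]) ?cards1 //.
by apply/setP=> i; rewrite !inE (ord1 i) eqxx.
Qed.

(* Main.v *)
(* Write p = phi(q), v = phi(q^3) and split p = a + b with a = phi(q^9) and b
   supported on exponents 1 modulo 3.  The lattice of integer vectors of length
   4 reducing modulo 3 into the tetracode is sqrt 3 Z^4, and its theta series
   is a^4 + a b^3, so a^4 + a b^3 = phi(q^3)^4.  Let U be the extraction of the
   coefficients of index divisible by 3.  Then N = U(p^3), which is a^3 + b^3
   read in q^3, equals p^4 / v, and p^9 = (a + b)^9 = N(q^3)^3 modulo 9, so that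
   U(p^-k) = N^-3 U(p^(9-k)) modulo 9.  For k = 3, 4, 7, 8 the right-hand side
   is a binomial expansion, which gives the four steps of the induction
   p^-3 -> v / p^4 -> v^4 / p^7 -> v^5 / p^8 -> v^4 / p^7.  Modulo 8 everything
   follows from p^4 = 1.

   That overpartitions are counted by 1 / phi(-q) comes from Gauss's identity
   phi(-q) = prod (1 - q^i) / (1 + q^i), a limit of the finite identity
     sum_j (-1)^j q^(j^2) / ((q)_(n-j) (q)_(n+j)) = 1 / (q^2; q^2)_n,
   proved by creative telescoping. *)
From HB Require Import structures.
From mathcomp Require Import all_boot all_order all_algebra.
From mathcomp Require Import boolp.
From mathcomp Require Import ring zify.
Require Import Defs.

Set Implicit Arguments.
Unset Strict Implicit.
Unset Printing Implicit Defensive.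

Import Order.TTheory GRing.Theory Num.Theory.
Local Open Scope ring_scope.

(** * Formal power series *)

(* A copy of [fps R], so that it can carry a ring structure with product [fps_mul]. *)
Definition series (R : comUnitRingType) : Type := nat -> R.

HB.instance Definition _ (R : comUnitRingType) := gen_eqMixin (series R).
HB.instance Definition _ (R : comUnitRingType) := gen_choiceMixin (series R).

Section SeriesRing.
Variable R : comUnitRingType.
Implicit Types f g h : series R.

Definition series_add f g : series R := fun n => f n + g n.
Definition series_opp f : series R := fun n => - f n.
Definition series_zero : series R := fun=> 0.

Lemma series_addA : associative series_add.
Proof. by move=> f g h; apply/funext=> n; apply: addrA. Qed.
Lemma series_addC : commutative series_add.
Proof. by move=> f g; apply/funext=> n; apply: addrC. Qed.
Lemma series_add0 : left_id series_zero series_add.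
Proof. by move=> f; apply/funext=> n; apply: add0r. Qed.
Lemma series_addN : left_inverse series_zero series_opp series_add.
Proof. by move=> f; apply/funext=> n; apply: addNr. Qed.

HB.instance Definition _ := GRing.isZmodule.Build (series R)
  series_addA series_addC series_add0 series_addN.

(** Below degree N a product of series only sees truncated factors, so associativity and
    commutativity are inherited from polynomials. *)
Definition trunc N f : {poly R} := \poly_(i < N) f i.

Lemma coef_trunc N f i : (i < N)%N -> (trunc N f)`_i = f i.
Proof. by rewrite coef_poly => ->. Qed.

Lemma fps_mul_trunc N f g n : (n < N)%N ->
  fps_mul f g n = (trunc N f * trunc N g)`_n.
Proof.
move=> nN; rewrite coefM; apply: eq_bigr => i _.
by rewrite !coef_trunc // (leq_ltn_trans _ nN) // ?leq_subr // -ltnS.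
Qed.

(** Truncation is not multiplicative; agreement of the factors up to degree n is what associativity
    needs. *)
Lemma coefM_low (p p' q q' : {poly R}) n :
  (forall i, (i <= n)%N -> p`_i = p'`_i) ->
  (forall i, (i <= n)%N -> q`_i = q'`_i) -> (p * q)`_n = (p' * q')`_n.
Proof.
move=> pp qq; rewrite !coefM; apply: eq_bigr => i _.
by rewrite pp ?qq ?leq_subr // -ltnS.
Qed.

Lemma coef_trunc_mul N f g i : (i < N)%N ->
  (trunc N (fps_mul f g))`_i = (trunc N f * trunc N g)`_i.
Proof. by move=> iN; rewrite coef_trunc // (fps_mul_trunc _ _ iN). Qed.

Lemma series_mulA : associative (@fps_mul R : series R -> series R -> series R).
Proof.
move=> f g h; apply/funext=> n; rewrite !(@fps_mul_trunc n.+1) //.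
rewrite (coefM_low (p' := trunc n.+1 f) (q' := trunc n.+1 g * trunc n.+1 h)) //.
  rewrite mulrA; apply: coefM_low => // i ni.
  by rewrite coef_trunc_mul.
by move=> i ni; rewrite coef_trunc_mul.
Qed.

Lemma series_mulC : commutative (@fps_mul R : series R -> series R -> series R).
Proof.
by move=> f g; apply/funext=> n; rewrite !(@fps_mul_trunc n.+1) // mulrC.
Qed.

Lemma series_mul1 :
  left_id (fps_one R : series R) (@fps_mul R : series R -> series R -> series R).
Proof.
move=> f; apply/funext=> n; rewrite /fps_mul big_ord_recl subn0 mul1r.
by rewrite big1 ?addr0 // => i _; rewrite mul0r.
Qed.

Lemma series_mulDl : left_distributive
  (@fps_mul R : series R -> series R -> series R) +%R.
Proof.
move=> f g h; apply/funext=> n; rewrite /fps_mul -[RHS]big_split /=.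
by apply: eq_bigr => i _; rewrite -mulrDl.
Qed.

Lemma series_1neq0 : (fps_one R : series R) != 0.
Proof.
apply/eqP => /(congr1 (fun f : series R => f 0%N)) /eqP.
by rewrite /fps_one eqxx oner_eq0.
Qed.

HB.instance Definition _ := GRing.Zmodule_isComNzRing.Build (series R)
  series_mulA series_mulC series_mul1 series_mulDl series_1neq0.

Lemma seriesD f g n : (f + g) n = f n + g n. Proof. by []. Qed.
Lemma seriesN f n : (- f) n = - f n. Proof. by []. Qed.
Lemma series0 n : (0 : series R) n = 0. Proof. by []. Qed.
Lemma series1 n : (1 : series R) n = (n == 0%N)%:R. Proof. by []. Qed.
Lemma seriesM f g n : (f * g) n = \sum_(i < n.+1) f i * g (n - i)%N.
Proof. by []. Qed.

Lemma series_sum I (r : seq I) (P : pred I) (F : I -> series R) n :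
  (\sum_(i <- r | P i) F i) n = \sum_(i <- r | P i) F i n.
Proof. by apply: (big_morph (fun f : series R => f n)) => [f g|] //. Qed.

Lemma series_muln f k n : (f *+ k) n = f n *+ k.
Proof. by elim: k => // k IH; rewrite !mulrS seriesD IH. Qed.

Lemma series_nat k n : (k%:R : series R) n = (k * (n == 0%N))%:R.
Proof. by rewrite series_muln series1 natrM mulr_natl. Qed.

Lemma fps_expE f k : fps_exp f k = (f : series R) ^+ k.
Proof. by elim: k => // k IH; rewrite exprS -IH. Qed.

Lemma fps_divK f g : g 0%N \is a GRing.unit ->
  (fps_div f g : series R) * g = f.
Proof.
move=> g0; rewrite /fps_div.
have gi : g * fps_inv g = 1 by apply/funext; apply: fps_mul_inv.
by rewrite -[fps_mul _ _]/((f : series R) * fps_inv g) -mulrA [_ * g]mulrC gi mulr1.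
Qed.

Definition mon k : series R := fun n => (n == k)%:R.

Lemma mon0 : mon 0 = 1. Proof. by []. Qed.

Lemma mon_mul k f n : (mon k * f) n = if (k <= n)%N then f (n - k)%N else 0.
Proof.
rewrite seriesM; case: leqP => kn.
  rewrite (bigD1 (Ordinal (kn : (k < n.+1)%N))) //= /mon eqxx mul1r.
  rewrite big1 ?addr0 // => i; rewrite -val_eqE /= => /negbTE ->.
  by rewrite mul0r.
rewrite big1 // => i _; rewrite /mon; case: eqP => [ik|]; last by rewrite mul0r.
by have := ltn_ord i; rewrite ik ltnS leqNgt kn.
Qed.

Lemma monD i j : mon (i + j)%N = mon i * mon j.
Proof.
apply/funext=> n; rewrite mon_mul /mon; case: leqP => h.
  by rewrite -(eqn_add2l i (n - i)) subnKC.
by case: eqP => // e; move: h; rewrite e ltnNge leq_addr.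
Qed.

(** Congruence modulo q^(N+1), which replaces limits and infinite sums by finite ones. *)
Definition eq_upto N f g := forall n, (n <= N)%N -> f n = g n.

Lemma eq_uptoM N f f' g g' :
  eq_upto N f f' -> eq_upto N g g' -> eq_upto N (f * g) (f' * g').
Proof.
move=> ff gg n nN; rewrite !seriesM; apply: eq_bigr => i _.
have iN : (i <= N)%N by apply: leq_trans nN; rewrite -ltnS.
by rewrite ff // gg // (leq_trans (leq_subr _ _)).
Qed.

(** The operator U of the overview; the substitution q -> q^3 below is its right inverse. *)
Definition sect3 f : series R := fun n => f (3 * n)%N.
Definition cube_subst f : series R := fps_subst_pow 3 f.

Lemma cube_substE f n : cube_subst f (3 * n)%N = f n.
Proof. by rewrite /cube_subst /fps_subst_pow dvdn_mulr // mulKn. Qed.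

Lemma cube_subst_ndvd f n : ~~ (3 %| n)%N -> cube_subst f n = 0.
Proof. by rewrite /cube_subst /fps_subst_pow => /negbTE ->. Qed.

Definition supp3 r f := forall n, f n != 0 -> n = r %[mod 3].

Lemma supp3M r s f g : supp3 r f -> supp3 s g -> supp3 (r + s) (f * g).
Proof.
move=> fr gs n; rewrite seriesM => nz.
have [i _ fg] : exists2 i : 'I_n.+1, true & f i * g (n - i)%N != 0.
  apply/exists_inP; apply: contraNT nz; rewrite negb_exists_in => /forall_inP h.
  by rewrite big1 // => i _; apply/eqP; rewrite -[_ == _]negbK; apply: h.
have fi : f i != 0 by apply: contraNneq fg => ->; rewrite mul0r.
have gi : g (n - i)%N != 0 by apply: contraNneq fg => ->; rewrite mulr0.
rewrite -(@subnKC i n) -1?ltnS //.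
by rewrite -modnDm (fr _ fi) (gs _ gi) modnDm.
Qed.

Lemma supp3_cube f : supp3 0 (cube_subst f).
Proof.
move=> n; case: (boolP (3 %| n)%N) => [/eqP -> //|h].
by rewrite (cube_subst_ndvd _ h) eqxx.
Qed.

Lemma sect3K f : supp3 0 f -> cube_subst (sect3 f) = f.
Proof.
move=> f0; apply/funext=> n; case: (boolP (3 %| n)%N) => h.
  by rewrite /cube_subst /fps_subst_pow h /sect3 mulnC divnK.
rewrite cube_subst_ndvd //; case: (f n =P 0) => // /eqP /f0 /eqP e.
by move: h; rewrite /dvdn -/(n == 0 %[mod 3]) e.
Qed.

Lemma sect3_cubeK f : supp3 1 f -> cube_subst (sect3 (f ^+ 3)) = f ^+ 3.
Proof.
move=> f1; apply: sect3K => k; rewrite !exprS expr0 mulr1.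
exact: (supp3M f1 (supp3M f1 f1)).
Qed.

Lemma cube_substK f : sect3 (cube_subst f) = f.
Proof. by apply/funext=> n; rewrite /sect3 cube_substE. Qed.

Lemma sect3D f g : sect3 (f + g) = sect3 f + sect3 g. Proof. by []. Qed.

Lemma sect3_supp r f : (r %% 3 != 0)%N -> supp3 r f -> sect3 f = 0.
Proof.
move=> r0 fr; apply/funext=> n; rewrite /sect3 series0.
case: (f (3 * n)%N =P 0) => // /eqP /fr e.
by move: r0; rewrite -e modnMr.
Qed.

Lemma sect3M f g : sect3 (cube_subst f * g) = f * sect3 g.
Proof.
apply/funext=> n; rewrite /sect3 !seriesM.
pose F i := cube_subst f i * g (3 * n - i)%N.
rewrite (eq_bigr (fun i : 'I_(3 * n).+1 => F i)) // -(big_mkord xpredT F).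
rewrite (eq_bigr (fun i : 'I_n.+1 => F (3 * i)%N)); last first.
  by move=> i _; rewrite /F cube_substE mulnBr.
rewrite -(big_mkord xpredT (fun i => F (3 * i)%N)).
(* Only the summation bounds vary; the n inside [F] stays fixed. In each block of three indices only
   the multiple of 3 contributes. *)
elim: {1 2}n => [|m IH]; first by rewrite muln0 !big_nat1 muln0.
rewrite [RHS]big_nat_recr //= -{}IH mulnS !addSn add0n 3?big_nat_recr //=.
have F0 i : ~~ (3 %| i)%N -> F i = 0.
  by move=> h; rewrite /F cube_subst_ndvd // mul0r.
rewrite (F0 (3 * m).+1); last by lia.
rewrite (F0 (3 * m).+2); last by lia.
by rewrite !addr0.
Qed.

Lemma cube_substM : {morph cube_subst : f g / f * g}.
Proof.
move=> f g; rewrite -[RHS]sect3K; first by rewrite sect3M cube_substK.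
exact: (supp3M (@supp3_cube f) (@supp3_cube g)).
Qed.

Lemma cube_substD : {morph cube_subst : f g / f + g}.
Proof.
move=> f g; apply/funext=> n; rewrite seriesD /cube_subst /fps_subst_pow.
by case: ifP => // _; rewrite addr0.
Qed.

Lemma cube_subst1 : cube_subst 1 = 1.
Proof.
apply/funext=> n; rewrite /cube_subst /fps_subst_pow.
case: ifP => [/dvdnP[m ->]|n3]; first by rewrite mulnK // !series1 muln_eq0 orbF.
by rewrite series1; case: n n3.
Qed.

Lemma cube_nat k : cube_subst (k%:R : series R) = k%:R.
Proof.
elim: k => [|k IH]; last by rewrite mulrS cube_substD IH cube_subst1.
by apply/funext => k; rewrite /cube_subst /fps_subst_pow if_same.
Qed.

Lemma cube_substX f k : cube_subst (f ^+ k) = cube_subst f ^+ k.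
Proof. by elim: k => [|k IH]; rewrite ?cube_subst1 // !exprS cube_substM IH. Qed.

Definition opp_subst f : series R := fps_subst_opp f.

Lemma opp_substK : involutive opp_subst.
Proof.
move=> f; apply/funext=> n; rewrite /opp_subst /fps_subst_opp mulrA -expr2.
by rewrite sqrr_sign mul1r.
Qed.

Lemma opp_substM : {morph opp_subst : f g / f * g}.
Proof.
move=> f g; apply/funext=> n; rewrite /opp_subst /fps_subst_opp !seriesM.
rewrite mulr_sumr; apply: eq_bigr => i _.
have le_in : (i <= n)%N by rewrite -ltnS.
by rewrite -{1}(subnKC le_in) exprD !mulrA; congr (_ * _); rewrite mulrAC.
Qed.

Lemma opp_subst1 : opp_subst 1 = 1.
Proof.
apply/funext=> -[|n]; first by rewrite /opp_subst /fps_subst_opp mul1r.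
by rewrite /opp_subst /fps_subst_opp !series1 mulr0.
Qed.

Lemma opp_substX f k : opp_subst (f ^+ k) = opp_subst f ^+ k.
Proof. by elim: k => [|k IH]; rewrite ?opp_subst1 // !exprS opp_substM IH. Qed.
End SeriesRing.
Arguments mon R k%_N.

(** * Reduction of integer coefficients *)

Section MapSeries.
Variables (R : comUnitRingType).

Definition map_series (f : series int) : series R := fun n => (f n)%:~R.

Lemma map_seriesM : {morph map_series : f g / f * g}.
Proof.
move=> f g; apply/funext=> n; rewrite /map_series !seriesM rmorph_sum /=.
by apply: eq_bigr => i _; rewrite rmorphM.
Qed.

Lemma map_series1 : map_series 1 = 1.
Proof. by apply/funext=> n; rewrite /map_series !series1; case: eqP. Qed.

Lemma map_seriesX f k : map_series (f ^+ k) = map_series f ^+ k.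
Proof. by elim: k => [|k IH]; rewrite ?map_series1 // !exprS map_seriesM IH. Qed.

Lemma map_series_cube f : map_series (cube_subst f) = cube_subst (map_series f).
Proof.
apply/funext=> n; rewrite /map_series /cube_subst /fps_subst_pow.
by case: ifP.
Qed.

End MapSeries.

(** * Dissections modulo 9 and modulo 8 *)

Section Nine.
Variables (R : comUnitRingType) (p b P : series R).
Let v := cube_subst p.
Let a := cube_subst v.
Hypothesis R9 : 9%:R = 0 :> R.
Hypothesis pE : p = a + b.
Hypothesis bsupp : supp3 1 b.
Hypothesis theta4 : v ^+ 4 = a ^+ 4 + a * b ^+ 3.
Hypothesis Pp3 : P * p ^+ 3 = 1.

Let S9 (f : series R) : 9%:R * f = 0.
Proof. by apply/funext=> n; rewrite mulr_natl series_muln -mulr_natl R9 mul0r. Qed.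

(** This is 1 / p, since P = 1 / p^3. Below, [n] is the series N of the overview and [c] is b^3 with
    q^3 replaced by q. *)
Let p' := P * p ^+ 2.
Let n := sect3 (p ^+ 3).
Let c := sect3 (b ^+ 3).

Let pp' : p' * p = 1. Proof. by rewrite /p' -mulrA -exprSr. Qed.

Let cE : cube_subst c = b ^+ 3.
Proof. exact: sect3_cubeK. Qed.

Let b0 f : sect3 (cube_subst f * b) = 0.
Proof. by rewrite sect3M (sect3_supp _ bsupp) ?mulr0. Qed.

Let bb0 f : sect3 (cube_subst f * b ^+ 2) = 0.
Proof. by rewrite sect3M (sect3_supp (r := 2)) ?mulr0 //; apply: (supp3M bsupp bsupp). Qed.

(** The powers 1, b, b^2 have exponents 0, 1, 2 modulo 3. Each section of a power of p is found by
    writing its binomial expansion in this form, with b^3 absorbed into the coefficients. *)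
Let dissect (x y z : series R) :
  sect3 (cube_subst x + cube_subst y * b + cube_subst z * b ^+ 2) = x.
Proof. by rewrite !sect3D b0 bb0 cube_substK !addr0. Qed.

Let nE : n = v ^+ 3 + c.
Proof.
rewrite /n -(dissect (v ^+ 3 + c) (3%:R * v ^+ 2) (3%:R * v)).
congr sect3; rewrite pE !(cube_substD, cube_substX, cube_substM, cube_nat) cE -/a.
ring.
Qed.

Let cube_n : cube_subst n = a ^+ 3 + b ^+ 3.
Proof. by rewrite nE cube_substD cube_substX cE. Qed.

(** After q -> q^3 this is (a^3 + b^3) a = v^4, which is [theta4]. *)
Let nv : n * v = p ^+ 4.
Proof.
rewrite -[LHS]cube_substK cube_substM cube_n -/a -[RHS]cube_substK.
by congr sect3; rewrite cube_substX -/v theta4; ring.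
Qed.

Let p9 : p ^+ 9 = cube_subst n ^+ 3.
Proof.
(* The cofactor is ((a + b)^9 - (a^3 + b^3)^3) / 9. *)
rewrite cube_n pE -[RHS]addr0 -(S9 (a ^+ 8 * b + 4%:R * a ^+ 7 * b ^+ 2
  + 9%:R * a ^+ 6 * b ^+ 3 + 14%:R * a ^+ 5 * b ^+ 4 + 14%:R * a ^+ 4 * b ^+ 5
  + 9%:R * a ^+ 3 * b ^+ 6 + 4%:R * a ^+ 2 * b ^+ 7 + a * b ^+ 8)).
ring.
Qed.

(** This is 1 / N, read off from [nv]. *)
Let n' := v * p' ^+ 4.

Let nn' : n * n' = 1.
Proof. by rewrite /n' mulrA nv -exprMn [p * _]mulrC pp' expr1n. Qed.

Let p'9 : p' ^+ 9 = cube_subst (n' ^+ 3).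
Proof.
have e : cube_subst n ^+ 3 * cube_subst (n' ^+ 3) = 1.
  by rewrite cube_substX -exprMn -cube_substM nn' cube_subst1 expr1n.
by rewrite -[LHS]mulr1 -e -p9 mulrA -exprMn pp' expr1n mul1r.
Qed.

(** Modulo 9 the series p^-9 is a series in q^3 and passes through U; what remains is a positive
    power of p, with a finite expansion. *)
Let sect3_p' i j : (i + j = 9)%N -> sect3 (p' ^+ i) = n' ^+ 3 * sect3 (p ^+ j).
Proof.
move=> ij; rewrite -sect3M -p'9 -ij exprD -mulrA -exprMn pp' expr1n.
by rewrite mulr1.
Qed.

(** The exact section is v^6 + 20 v^3 c + c^2, whereas N^2 has coefficient 2 in the middle; the
    difference 18 vanishes modulo 9. *)
Let sect3_p6 : sect3 (p ^+ 6) = n ^+ 2.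
Proof.
rewrite -[RHS]addr0 -(S9 (2%:R * v ^+ 3 * c)) -[RHS](dissect _
  (6%:R * v ^+ 5 + 15%:R * v ^+ 2 * c) (15%:R * v ^+ 4 + 6%:R * v * c)).
rewrite !(cube_substD, cube_substX, cube_substM, cube_nat) cE cube_n -/a.
by congr sect3; rewrite pE; ring.
Qed.

(** The exact section is v^5 + 10 v^2 c, and 10 = 1 modulo 9. *)
Let sect3_p5 : sect3 (p ^+ 5) = v ^+ 2 * n.
Proof.
rewrite -[RHS]addr0 -(S9 (v ^+ 2 * c)) -[RHS](dissect _
  (5%:R * v ^+ 4 + 5%:R * v * c) (10%:R * v ^+ 3 + c)).
rewrite !(cube_substD, cube_substX, cube_substM, cube_nat) cE cube_n -/a.
by congr sect3; rewrite pE; ring.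
Qed.

Let sect3_p2 : sect3 (p ^+ 2) = v ^+ 2.
Proof.
rewrite -(dissect (v ^+ 2) (2%:R * v) 1).
rewrite !(cube_substD, cube_substX, cube_substM, cube_nat) cube_subst1 -/a.
by congr sect3; rewrite pE; ring.
Qed.

Let sect3_p1 : sect3 (p ^+ 1) = v.
Proof.
rewrite -(dissect v 1 0) cube_subst1 -/a mul1r (cube_nat R 0) mul0r addr0.
by rewrite -pE.
Qed.

Let p'3 : p' ^+ 3 = P.
Proof.
by rewrite -[LHS]mulr1 -Pp3 mulrCA -exprMn pp' expr1n mulr1.
Qed.

Let n'3n2 : n' ^+ 3 * n ^+ 2 = n'.
Proof. by rewrite exprSr mulrAC -exprMn [n' * _]mulrC nn' expr1n mul1r. Qed.

Lemma sect3_sect3_nine : sect3 (sect3 P) * p ^+ 7 = v ^+ 4.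
Proof.
have -> : sect3 P = v * p' ^+ 4.
  by rewrite -p'3 (@sect3_p' 3 6) // sect3_p6 n'3n2.
(* The factor v is p in q^3, so it leaves [sect3] as p. *)
rewrite sect3M (@sect3_p' 4 5) // sect3_p5.
have -> : n' ^+ 3 * (v ^+ 2 * n) = v ^+ 2 * n' ^+ 2 * (n * n') by ring.
rewrite nn' mulr1 /n'.
have -> : p * (v ^+ 2 * (v * p' ^+ 4) ^+ 2) * p ^+ 7 = v ^+ 4 * (p' * p) ^+ 8.
  ring.
by rewrite pp' expr1n mulr1.
Qed.

(** Here f = v^4 / p^7. The factor v^4 leaves U as p^4, and U(p^-7) = N^-3 v^2 = v^5 / p^12. *)
Lemma sect3_even_nine f : f * p ^+ 7 = v ^+ 4 -> sect3 f * p ^+ 8 = v ^+ 5.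
Proof.
move=> fE; have -> : f = v ^+ 4 * p' ^+ 7.
  by rewrite -fE -mulrA -exprMn [p * _]mulrC pp' expr1n mulr1.
rewrite -cube_substX sect3M (@sect3_p' 7 2) // sect3_p2 /n'.
transitivity (v ^+ 5 * (p' * p) ^+ 12); first ring.
by rewrite pp' expr1n mulr1.
Qed.

(** Here f = v^5 / p^8. The factor v^5 leaves U as p^5, and U(p^-8) = N^-3 v = v^4 / p^12. *)
Lemma sect3_odd_nine f : f * p ^+ 8 = v ^+ 5 -> sect3 f * p ^+ 7 = v ^+ 4.
Proof.
move=> fE; have -> : f = v ^+ 5 * p' ^+ 8.
  by rewrite -fE -mulrA -exprMn [p * _]mulrC pp' expr1n mulr1.
rewrite -cube_substX sect3M (@sect3_p' 8 1) // sect3_p1 /n'.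
transitivity (v ^+ 4 * (p' * p) ^+ 12); first ring.
by rewrite pp' expr1n mulr1.
Qed.
End Nine.

(** * The induction steps modulo 8 *)

Section Eight.
Variables (R : comUnitRingType) (p b s P : series R).
Let v := cube_subst p.
Hypothesis R8 : 8%:R = 0 :> R.
Hypothesis pE : p = cube_subst v + b.
Hypothesis bsupp : supp3 1 b.
Hypothesis podd : p = 1 + 2%:R * s.
Hypothesis Pp3 : P * p ^+ 3 = 1.

Let p4 : p ^+ 4 = 1.
Proof.
have -> : p ^+ 4 = 1 + 8%:R * (s + 3%:R * s ^+ 2 + 4%:R * s ^+ 3 + 2%:R * s ^+ 4).
  by rewrite podd; ring.
suff -> : 8%:R = 0 :> series R by rewrite mul0r addr0.
by apply/funext=> n; rewrite series_nat natrM R8 mul0r.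
Qed.

Let v4 : v ^+ 4 = 1.
Proof. by rewrite -cube_substX p4 cube_subst1. Qed.

Let sect3_p : sect3 p = v.
Proof.
by rewrite pE sect3D cube_substK (sect3_supp _ bsupp) // addr0.
Qed.

(** Since p^4 = v^4 = 1, the series p^-3 and v^4 / p^7 are both p, while v^5 / p^8 is v; U exchanges
    p and v. *)
Lemma sect3_sect3_eight : sect3 (sect3 P) * p ^+ 7 = v ^+ 4.
Proof.
have -> : P = p by rewrite -[LHS]mulr1 -p4 exprSr mulrA Pp3 mul1r.
by rewrite sect3_p cube_substK -exprS (exprM p 4 2) p4 v4 expr1n.
Qed.

Lemma sect3_even_eight f : f * p ^+ 7 = v ^+ 4 -> sect3 f * p ^+ 8 = v ^+ 5.
Proof.
rewrite v4 => fE; have -> : f = p.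
  by rewrite -[f]mulr1 -(expr1n _ 2) -p4 -exprM exprSr mulrA fE mul1r.
by rewrite sect3_p (exprM p 4 2) p4 expr1n (exprS v) v4.
Qed.

Lemma sect3_odd_eight f : f * p ^+ 8 = v ^+ 5 -> sect3 f * p ^+ 7 = v ^+ 4.
Proof.
rewrite (exprM p 4 2) p4 expr1n (exprS v) v4 !mulr1 => ->.
by rewrite cube_substK -exprS (exprM p 4 2) p4 expr1n.
Qed.
End Eight.

(** * Theta series and the tetracode *)

(** The integers of absolute value at most N, ordered so that [phi_sum] can fold k and -k
    together. *)
Definition box (N : nat) : seq int :=
  [seq k%:Z | k <- iota 0 N.+1] ++ [seq - k%:Z | k <- iota 1 N].

Lemma mem_box N (k : int) : (k \in box N) = (`|k| <= N)%N.
Proof.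
rewrite mem_cat; apply/orP/idP => [[]/mapP[i]|kN]; rewrite ?mem_iota.
- by move=> /andP[_ iN] ->; rewrite absz_nat -ltnS.
- by move=> /andP[_ iN] ->; rewrite abszN absz_nat -ltnS.
case: (lerP 0 k) => k0; [left|right]; apply/mapP; exists `|k|%N.
- by rewrite mem_iota.
- by rewrite gez0_abs.
- by rewrite mem_iota; lia.
- by rewrite ltz0_abs // opprK.
Qed.

Lemma uniq_box N : uniq (box N).
Proof.
rewrite cat_uniq !map_inj_uniq ?iota_uniq ?andbT //; last first.
- by move=> i j e; lia.
- by move=> i j e; lia.
rewrite andTb; apply/hasPn => x /mapP[i]; rewrite mem_iota => /andP[i0 _] ->.
by apply/mapP => -[j _ e]; lia.
Qed.

(** Counting by a bijection f, which has to be injective and well defined only where the predicates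
    hold. *)
Lemma count_perm (T T' : eqType) (f : T -> T') (A : pred T) (B : pred T') r s :
    uniq r -> uniq s -> {in r &, forall x y, A x -> A y -> f x = f y -> x = y} ->
    (forall x, x \in r -> A x -> (f x \in s) && B (f x)) ->
    (forall y, y \in s -> B y -> exists2 x, (x \in r) && A x & f x = y) ->
  count A r = count B s.
Proof.
move=> ru su inj fAB fBA; rewrite -!size_filter -(size_map f).
apply: perm_size; apply: uniq_perm; rewrite ?filter_uniq //.
  rewrite map_inj_in_uniq ?filter_uniq // => x y.
  by rewrite !mem_filter => /andP[Ax xr] /andP[Ay yr]; apply: inj.
move=> y; apply/mapP/idP => [[x]|]; rewrite mem_filter => /andP[].
  by move=> Ax xr ->; rewrite mem_filter andbC fAB.
move=> By /fBA /(_ By)[x /andP[xr Ax] <-]; exists x => //.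
by rewrite mem_filter Ax.
Qed.

Lemma mem_pairs (T U : eqType) (r : seq T) (s : seq U) x y :
  ((x, y) \in allpairs pair r s) = (x \in r) && (y \in s).
Proof.
by apply/allpairsP/andP => [[[u w] /= [ur ws [-> ->]]] //|[xr ys]]; exists (x, y).
Qed.

Lemma uniq_pairs (T U : eqType) (r : seq T) (s : seq U) :
  uniq r -> uniq s -> uniq (allpairs pair r s).
Proof. by move=> ur us; apply: allpairs_uniq => // -[? ?] [? ?]. Qed.

Lemma count_box_widen (A : pred int) n N : (n <= N)%N ->
  (forall k, A k -> (`|k| <= n)%N) -> count A (box N) = count A (box n).
Proof.
move=> nN An; apply: (@count_perm _ _ id); rewrite ?uniq_box //.
  by move=> k _ Ak; rewrite Ak mem_box An.
move=> k; rewrite mem_box => kn Ak; exists k => //.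
by rewrite mem_box Ak (leq_trans kn).
Qed.

Lemma sqr_absz_le (k : int) n : (`|k| ^ 2)%N = n -> (`|k| <= n)%N.
Proof. by move=> <-; rewrite expnS expn1; case: `|k|%N => // m; rewrite leq_pmulr. Qed.

Definition residue3 (c k : int) : bool := (k %% 3 == c)%Z.

Lemma absz_sqr (k : int) : (`|k| ^ 2)%N%:Z = k ^+ 2.
Proof. by rewrite -abszX gez0_abs ?sqr_ge0. Qed.

Section Theta.
Variable R : comUnitRingType.

(** The sum of q^(k^2) over the integers k in A. As |k| <= k^2, [box n] contains every k that counts
    in degree n. *)
Definition theta (A : pred int) : series R :=
  fun n => (count (fun k => A k && (`|k| ^ 2 == n)%N) (box n))%:R.

Lemma sum_mon_coef I (r : seq I) (A : pred I) (e : I -> nat) n :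
  (\sum_(i <- r | A i) mon R (e i)) n = (count (fun i => A i && (e i == n)) r)%:R.
Proof.
rewrite series_sum -sum1_count natr_sum [LHS]big_mkcond [RHS]big_mkcond /=.
by apply: eq_bigr => i _; rewrite /mon eq_sym; case: (A i); case: eqP.
Qed.

Lemma theta_sum A N :
  eq_upto N (theta A) (\sum_(k <- box N | A k) mon R (`|k| ^ 2)).
Proof.
move=> n nN; rewrite sum_mon_coef /theta; congr _%:R.
by symmetry; apply: count_box_widen => // k /andP[_ /eqP]; apply: sqr_absz_le.
Qed.

Lemma sum_mon_mul I J (r : seq I) (s : seq J) (A : pred I) (B : pred J) e f :
  (\sum_(i <- r | A i) mon R (e i)) * (\sum_(j <- s | B j) mon R (f j)) =
  \sum_(x <- allpairs pair r s | A x.1 && B x.2) mon R (e x.1 + f x.2).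
Proof.
rewrite mulr_suml big_mkcond [RHS]big_mkcond big_allpairs /=.
apply: eq_bigr => i _; case: (A i); last by rewrite big1.
rewrite mulr_sumr big_mkcond; apply: eq_bigr => j _ /=.
by case: (B j); rewrite ?monD.
Qed.

Lemma thetaD A B : (forall k, ~~ (A k && B k)) ->
  theta A + theta B = theta (predU A B).
Proof.
move=> AB; apply/funext=> n; rewrite seriesD /theta -natrD; congr _%:R.
rewrite -count_predUI addnC (eq_count (a2 := pred0)) ?count_pred0 ?add0n.
  by apply: eq_count => k /=; rewrite andb_orl.
by move=> k /=; have /negbTE := AB k; case: (A k); case: (B k) => //=; rewrite andbF.
Qed.

Lemma eq_theta A B : A =1 B -> theta A = theta B.
Proof.
move=> AB; apply/funext=> n; congr _%:R; apply: eq_count => k /=.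
by rewrite AB.
Qed.

Lemma thetaN A B : (forall k, A k = B (- k)) -> theta A = theta B.
Proof.
move=> AB; apply/funext=> n; congr _%:R.
apply: (@count_perm _ _ (fun k => - k)); rewrite ?uniq_box //.
- by move=> k l _ _ _ _ e; lia.
- by move=> k; rewrite !mem_box !abszN AB => -> ->.
by move=> k; rewrite mem_box => kn Bk; exists (- k); rewrite ?mem_box ?abszN ?AB opprK ?kn.
Qed.

Definition box4 N := allpairs pair (allpairs pair (box N) (box N))
                                   (allpairs pair (box N) (box N)).

Definition norm4 (x : (int * int) * (int * int)) : nat :=
  (`|x.1.1| ^ 2 + `|x.1.2| ^ 2 + (`|x.2.1| ^ 2 + `|x.2.2| ^ 2))%N.

Lemma theta4_coef A B C D n :
  (theta A * theta B * (theta C * theta D)) n =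
  (count (fun x => A x.1.1 && B x.1.2 && (C x.2.1 && D x.2.2) && (norm4 x == n))
         (box4 n))%:R.
Proof.
rewrite (eq_uptoM (eq_uptoM (@theta_sum A n) (@theta_sum B n))
                  (eq_uptoM (@theta_sum C n) (@theta_sum D n)) (leqnn n)).
by rewrite !sum_mon_mul sum_mon_coef.
Qed.

Lemma mem_box4 N x : (x \in box4 N) =
  [&& `|x.1.1| <= N, `|x.1.2| <= N, `|x.2.1| <= N & `|x.2.2| <= N]%N.
Proof.
by case: x => [[x y] [z t]]; rewrite /box4 !mem_pairs !mem_box -andbA.
Qed.

Lemma uniq_box4 N : uniq (box4 N).
Proof.
by rewrite /box4 !uniq_pairs ?uniq_box.
Qed.

(* The tetracode: a self-dual code over F_3 in which every nonzero word has
   exactly one zero coordinate. *)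
Definition tetracode (x : (int * int) * (int * int)) : bool :=
  ((x.1.2 + x.2.1 + x.2.2) %% 3 == 0)%Z && ((x.2.1 - x.1.1 - x.2.2) %% 3 == 0)%Z.

(* Multiplication by a skew conference matrix C, with C C^T = 3 and C^2 = -3,
   whose row space modulo 3 is the tetracode. *)
Definition conf_mul (x : (int * int) * (int * int)) : (int * int) * (int * int) :=
  ((x.1.2 + x.2.1 + x.2.2, x.2.1 - x.1.1 - x.2.2),
   (x.2.2 - x.1.1 - x.1.2, x.1.2 - x.1.1 - x.2.1)).

Lemma norm4_conf_mul x : norm4 (conf_mul x) = (3 * norm4 x)%N.
Proof.
case: x => [[x y] [z t]]; rewrite /norm4 /=.
by apply/eqP; rewrite -eqz_nat PoszM !PoszD !absz_sqr; apply/eqP; ring.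
Qed.

Lemma conf_mulK x : conf_mul (conf_mul x) =
  ((- (3 * x.1.1), - (3 * x.1.2)), (- (3 * x.2.1), - (3 * x.2.2))).
Proof. by case: x => [[x y] [z t]]; rewrite /conf_mul /=; congr ((_, _), (_, _)); ring. Qed.

Lemma norm4_box n x : norm4 x = n -> x \in box4 n.
Proof.
case: x => [[x y] [z t]]; rewrite mem_box4 /norm4 /=.
have sq (k : int) : (`|k| <= `|k| ^ 2)%N by apply: (sqr_absz_le (erefl _)).
move: (sq x) (sq y) (sq z) (sq t).
move: (`|x| ^ 2)%N (`|y| ^ 2)%N (`|z| ^ 2)%N (`|t| ^ 2)%N => x2 y2 z2 t2; lia.
Qed.

(** The matrix C maps Z^4 bijectively onto the vectors that reduce into the tetracode, and triples
    the norm. *)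
Lemma count_tetracode n :
  count (fun x => norm4 x == n) (box4 n) =
  count (fun x => tetracode x && (norm4 x == 3 * n)%N) (box4 (3 * n)).
Proof.
apply: (@count_perm _ _ conf_mul); rewrite ?uniq_box4 //.
- move=> x y _ _ _ _ /(congr1 conf_mul); rewrite !conf_mulK.
  by case: x y => [[? ?] [? ?]] [[? ?] [? ?]] /= [] *; congr ((_, _), (_, _)); lia.
- move=> x _ /eqP xn; rewrite norm4_box ?norm4_conf_mul ?xn // eqxx andbT /=.
  by case: x {xn} => [[x y] [z t]]; rewrite /tetracode /=; lia.
move=> y _ /andP[ty /eqP yn].
pose x := conf_mul y.
have [z zE] : exists z, conf_mul z = y.
  (* As C^2 = -3, the preimage of y is -C y / 3, which is integral because y lies in the tetracode
     modulo 3. *)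
  exists ((- (x.1.1 %/ 3)%Z, - (x.1.2 %/ 3)%Z), (- (x.2.1 %/ 3)%Z, - (x.2.2 %/ 3)%Z)).
  move: ty; rewrite /x; case: (y) => [[a b] [c d]]; rewrite /tetracode /conf_mul /=.
  by move=> ?; congr ((_, _), (_, _)); lia.
exists z => //; have zn : norm4 z = n by move: yn; rewrite -zE norm4_conf_mul; lia.
by rewrite norm4_box // zn eqxx.
Qed.

Definition tetracode_words : seq ((int * int) * (int * int)) :=
  [:: ((0, 0), (0, 0)); ((1, 2), (1, 0)); ((2, 1), (2, 0));
      ((2, 2), (0, 1)); ((1, 1), (0, 2)); ((0, 1), (1, 1));
      ((0, 2), (2, 2)); ((2, 0), (1, 2)); ((1, 0), (2, 1))].

(** Membership depends only on residues modulo 3, which leaves 81 cases. *)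
Lemma tetracode_split x : nat_of_bool (tetracode x) =
  (\sum_(c <- tetracode_words)
    (residue3 c.1.1 x.1.1 && residue3 c.1.2 x.1.2 &&
     (residue3 c.2.1 x.2.1 && residue3 c.2.2 x.2.2)))%N.
Proof.
case: x => [[x y] [z t]]; rewrite /tetracode /residue3 unlock /=.
have -> : ((y + z + t) %% 3)%Z = (((y %% 3)%Z + (z %% 3)%Z + (t %% 3)%Z) %% 3)%Z by lia.
have -> : ((z - x - t) %% 3)%Z = (((z %% 3)%Z - (x %% 3)%Z - (t %% 3)%Z) %% 3)%Z by lia.
have r3 (k : int) : (k %% 3)%Z \in [:: 0; 1; 2] by rewrite !inE; lia.
by move: (r3 x) (r3 y) (r3 z) (r3 t); rewrite !inE;
  do 4!move=> /or3P[]/eqP->.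
Qed.

End Theta.

(** * The 3-dissection of phi and its quartic relation *)

Section PhiDissection.
Variable R : comUnitRingType.

Local Notation theta := (theta R).
Local Notation th c := (theta (residue3 c)).

Definition phi_series : series R := map_series R phi.

Lemma phiE : phi_series = theta predT.
Proof.
apply/funext=> n; rewrite /phi_series /map_series /phi /theta -pmulrn; congr _%:R.
rewrite cardE /enum_mem size_filter -enumT.
apply: (@count_perm _ _ (fun i : 'I_n.*2.+1 => i%:Z - n%:Z)).
- exact: enum_uniq.
- exact: uniq_box.
- by move=> i j _ _ _ _ e; apply: ord_inj; lia.
- move=> i _; rewrite mem_box /= -eqz_nat absz_sqr !inE => ->.
  by have := ltn_ord i; lia.
move=> k; rewrite mem_box /= -eqz_nat absz_sqr => kn kE.
have kb : (absz (k + n%:Z)%R < n.*2.+1)%N by lia.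
have ke : (absz (k + n%:Z))%:Z - n%:Z = k by lia.
by exists (Ordinal kb); rewrite ?mem_enum ?inE /= ke.
Qed.

Lemma theta_neg : th 2 = th 1.
Proof. by apply: thetaN => l; rewrite /residue3; lia. Qed.

Lemma theta_split : theta predT = th 0 + 2%:R * th 1.
Proof.
have -> : 2%:R * th 1 = th 1 + th 2 by rewrite theta_neg; ring.
rewrite !thetaD; first by apply: eq_theta => k; rewrite /= /residue3; lia.
  by move=> k; rewrite /residue3 /=; lia.
by move=> k; rewrite /residue3 /=; lia.
Qed.

(** Multiples of 3 have squares 9 l^2, so they contribute phi(q^9). *)
Lemma theta_scale : th 0 = cube_subst (cube_subst (theta predT)).
Proof.
apply/funext=> n; rewrite /cube_subst /fps_subst_pow.
case: (boolP (9 %| n)%N) => n9.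
  have n3 : (3 %| n)%N by lia.
  have n33 : (3 %| n %/ 3)%N by lia.
  rewrite n3 n33 -divnMA /theta; congr _%:R; symmetry.
  have [m mE] : exists m, n = (9 * m)%N by exists (n %/ 9)%N; lia.
  rewrite mE mulKn //.
  apply: (@count_perm _ _ (fun k => 3 * k)); rewrite ?uniq_box //.
  - by move=> k l _ _ _ _ e; lia.
  - move=> k; rewrite !mem_box /residue3 /= => km /eqP e; nia.
  move=> k; rewrite mem_box /residue3 /= => km /andP[k3 /eqP e].
  exists (k %/ 3)%Z; last by lia.
  rewrite mem_box.
  have [l lE] : exists l, k = 3 * l by exists (k %/ 3)%Z; lia.
  have lm : (`|l| ^ 2)%N = m by move: e; rewrite lE; nia.
  by rewrite lE mulKz // lm eqxx (sqr_absz_le lm).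
have th0 : th 0 n = 0.
  rewrite /theta (eq_count (a2 := pred0)) ?count_pred0 // => k /=.
  apply/negbTE; apply: contra n9; rewrite /residue3 => /andP[k3 /eqP <-].
  by rewrite (_ : 9 = 3 ^ 2)%N // dvdn_exp2r //; lia.
rewrite th0; case: ifP => // n3; case: ifP => // n33; lia.
Qed.

Lemma theta_supp : supp3 1 (2%:R * th 1).
Proof.
move=> n; rewrite mulr_natl series_muln /theta.
set A := (fun k => _); case: (boolP (has A (box n))) => [/hasP[k _]|].
  by rewrite /A /residue3 => /andP[k1 /eqP <-] _; lia.
by rewrite has_count -leqNgt leqn0 => /eqP ->; rewrite mul0rn eqxx.
Qed.

(** The zero word gives the first term. Each of the eight other words has one zero coordinate, and
    the classes 1 and 2 have the same theta series. *)
Lemma theta_tetracode :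
  th 0 ^+ 4 + 8%:R * th 0 * th 1 ^+ 3 =
  (fun n => (count (fun x => tetracode x && (norm4 x == n)) (box4 n))%:R) :> series R.
Proof.
pose q (c : (int * int) * (int * int)) :=
  th c.1.1 * th c.1.2 * (th c.2.1 * th c.2.2).
have -> : th 0 ^+ 4 + 8%:R * th 0 * th 1 ^+ 3 =
  \sum_(c <- tetracode_words) q c.
  by rewrite /tetracode_words !big_cons big_nil /q /= theta_neg; ring.
apply/funext=> n; rewrite series_sum.
under eq_bigr do rewrite /q theta4_coef.
rewrite -natr_sum; congr _%:R.
under eq_bigr do rewrite -sum1_count big_mkcond.
rewrite exchange_big -sum1_count [RHS]big_mkcond; apply: eq_bigr => x _ /=.
case: (norm4 x == n); last first.
  by rewrite andbF big1 // => c _; rewrite andbF.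
rewrite andbT -[RHS]/(nat_of_bool (tetracode x)) tetracode_split.
by apply: eq_bigr => c _; rewrite andbT; case: ifP.
Qed.

(** By [count_tetracode], the coefficient of the tetracode series at 3n counts the vectors of norm n
    in Z^4. *)
Lemma theta_quartic :
  theta predT ^+ 4 = sect3 (th 0 ^+ 4 + 8%:R * th 0 * th 1 ^+ 3).
Proof.
rewrite theta_tetracode; apply/funext=> n; rewrite /sect3 -count_tetracode.
have -> : theta predT ^+ 4 =
  theta predT * theta predT * (theta predT * theta predT) by ring.
by rewrite theta4_coef.
Qed.

Let p := phi_series.
Let v := cube_subst p.
Let a := cube_subst v.
Let b := 2%:R * th 1.

Lemma phi_dissection : p = a + b.
Proof. by rewrite /b /a /v /p phiE {1}theta_split theta_scale. Qed.

(** With b = 2 [th 1] the tetracode series is a^4 + a b^3. It is a series in q^3, so the section in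
    [theta_quartic] loses nothing and can be undone. *)
Lemma phi_quartic : v ^+ 4 = a ^+ 4 + a * b ^+ 3.
Proof.
have tE : th 0 ^+ 4 + 8%:R * th 0 * th 1 ^+ 3 =
    cube_subst (v ^+ 4 + v * sect3 (b ^+ 3)).
  rewrite cube_substD cube_substM cube_substX (sect3_cubeK theta_supp).
  by rewrite /b /v /p phiE -theta_scale; ring.
rewrite -[LHS]cube_substX /p phiE theta_quartic tE cube_substK.
rewrite cube_substD cube_substM cube_substX (sect3_cubeK theta_supp).
by rewrite /a.
Qed.
End PhiDissection.

(** * Gauss's identity *)

Section PhiSum.
Variable R : comUnitRingType.

Lemma phi_sum N :
  eq_upto N (phi_series R) (1 + 2%:R * \sum_(1 <= j < N.+1) mon R (j ^ 2)).
Proof.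
move=> n nN; rewrite phiE (theta_sum R predT nN) /box big_cat !big_map /= big_cons /=.
under [X in _ + X]eq_bigr do rewrite abszN.
by rewrite -addrA -mulr2n -[X in _ + X]mulr_natl /index_iota subn1.
Qed.

Lemma phi_odd : exists s, phi_series R = 1 + 2%:R * s.
Proof.
exists (fun n => (count (fun j => j ^ 2 == n)%N (iota 1 n))%:R).
apply/funext=> n; rewrite (phi_sum (leqnn n)) /index_iota subn1 /=.
rewrite !seriesD !mulr_natl !series_muln; congr (_ + _ *+ _).
by rewrite sum_mon_coef.
Qed.
End PhiSum.

Section Gauss.
Variable R : comUnitRingType.
Local Notation mon := (mon R).

Definition qpoch n : series R := \prod_(1 <= i < n.+1) (1 - mon i).
Definition qpoch_plus n : series R := \prod_(1 <= i < n.+1) (1 + mon i).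
Definition qpoch_inv n : series R := fps_inv (qpoch n).
Local Notation u := qpoch_inv.

Lemma qpochS n : qpoch n.+1 = qpoch n * (1 - mon n.+1).
Proof. by rewrite /qpoch big_nat_recr. Qed.

Lemma qpochK n : qpoch n * u n = 1.
Proof.
apply/funext; apply: fps_mul_inv; suff -> : qpoch n 0%N = 1 by exact: unitr1.
elim: n => [|n IH]; first by rewrite /qpoch big_geq.
by rewrite qpochS seriesM big_ord1 IH seriesD seriesN /mon /= subr0 mul1r.
Qed.

Lemma qpoch_invS n : u n.+1 * (1 - mon n.+1) = u n.
Proof.
transitivity (u n.+1 * (1 - mon n.+1) * (qpoch n * u n)).
  by rewrite qpochK mulr1.
transitivity (qpoch n.+1 * u n.+1 * u n); first by rewrite qpochS; ring.
by rewrite qpochK mul1r.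
Qed.

(** The summand of the finite identity; [T n] is its sum over -n <= j <= n, folded by the symmetry j
    -> -j. *)
Let F n j : series R := (-1) ^+ j * mon (j ^ 2) * u (n - j) * u (n + j).
Let T n : series R := F n 0 + 2%:R * \sum_(1 <= j < n.+1) F n j.

(* The telescoping part of the creative-telescoping certificate. *)
Let G n j : series R := F n j * (1 - mon (n - j)) * mon (n + j).

Let F_step n j : (j <= n)%N ->
  F n.+1 j * (1 - mon (n.+1 - j)) * (1 - mon (n.+1 + j)) = F n j.
Proof.
move=> jn; rewrite /F -(qpoch_invS (n - j)) -(qpoch_invS (n + j)) subSn // addSn.
ring.
Qed.

Let G_step n j : (j < n)%N ->
  F n j.+1 * (1 - mon (n + j.+1)) * mon (n - j.+1) = - G n j.
Proof.
move=> jn; rewrite /G /F addnS -(qpoch_invS (n + j)).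
have -> : u (n - j.+1) = u (n - j) * (1 - mon (n - j)).
  by rewrite -qpoch_invS subnSK.
rewrite exprS.
have -> : mon (n + j) = mon (n - j.+1) * mon (j + j.+1).
  by rewrite -monD; congr mon; lia.
have -> : mon (j.+1 ^ 2) = mon (j ^ 2) * mon (j + j.+1).
  by rewrite -monD; congr mon; lia.
ring.
Qed.

(** For x = q^(n-j) and y = q^(n+j), 1 - xy = (1-x)(1-y) + (1-x)y + (1-y)x. The first part lowers n
    by [F_step]; the other two telescope by [G_step]. *)
Let F_diff n j : (j <= n)%N ->
  (1 - mon (2 * n)) * F n j =
  F n j * (1 - mon (n - j)) * (1 - mon (n + j)) + G n j
  + F n j * (1 - mon (n + j)) * mon (n - j).
Proof.
move=> jn; rewrite /G; have -> : mon (2 * n) = mon (n - j) * mon (n + j).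
  by rewrite -monD; congr mon; lia.
ring.
Qed.

Let T_step n : (1 - mon (2 * n.+1)) * T n.+1 = T n.
Proof.
have top : G n.+1 n.+1 = 0 by rewrite /G subnn mon0; ring.
have e j : (1 <= j < n.+2)%N -> (1 - mon (2 * n.+1)) * F n.+1 j =
    F n.+1 j * (1 - mon (n.+1 - j)) * (1 - mon (n.+1 + j))
    + (G n.+1 j - G n.+1 j.-1).
  by case: j => // j jn; rewrite F_diff // G_step //= addrA.
rewrite /T mulrDr [X in _ + X]mulrCA.
rewrite [X in _ + 2%:R * X = _]mulr_sumr (eq_big_nat _ _ e) big_split /=.
(* The term j = n+1 drops out because of its factor 1 - q^0. *)
rewrite big_nat_recr //= subnn mon0 subrr mulr0 mul0r addr0.
rewrite (eq_big_nat _ _ (F2 := F n)); last by move=> j /andP[_ jn]; apply: F_step.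
have -> : \sum_(1 <= j < n.+2) (G n.+1 j - G n.+1 j.-1) = - G n.+1 0.
  rewrite big_add1 /= telescope_sumr // top; ring.
(* At j = 0 both remainders in [F_diff] equal [G n.+1 0]; together they cancel twice the telescoped
   sum. *)
rewrite F_diff // -(F_step (leq0n n)) /G subn0 addn0; ring.
Qed.

(** The product [qpoch n * qpoch_plus n] is (q^2; q^2)_n, so this is the finite form of Gauss's
    identity. *)
Let T_prod n : T n * (qpoch n * qpoch_plus n) = 1.
Proof.
elim: n => [|n IH].
  rewrite /T /F big_geq // /qpoch_plus big_geq // mulr0 addr0.
  have q0 : qpoch 0 = 1 by rewrite /qpoch big_geq.
  have u0 : u 0 = 1 by rewrite -[LHS]mul1r -q0 qpochK.
  by rewrite q0 u0 mon0; ring.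
rewrite -{}IH -(T_step n) qpochS /qpoch_plus [X in _ * (_ * X)]big_nat_recr //=.
by rewrite mul2n -addnn monD; ring.
Qed.

(** Congruence to 1 modulo q^m, which measures how fast the summands of [T n * qpoch n ^+ 2]
    approach their limits. *)
Let near1 (m : nat) (f : series R) := exists h, f = 1 + mon m * h.

Let near1M m k f g : near1 m f -> near1 (m + k)%N g -> near1 m (f * g).
Proof.
move=> [h ->] [h' ->]; exists (h + mon k * h' + mon (m + k) * h * h').
by rewrite monD; ring.
Qed.

(** The quotient is the product of the factors 1 - q^i with i > m. *)
Let qpoch_near m k : near1 m.+1 (qpoch (m + k) * u m).
Proof.
elim: k => [|k IH]; first by rewrite addn0 qpochK; exists 0; ring.
rewrite addnS qpochS mulrAC; apply: near1M IH _.
by exists (-1); rewrite -addSn; ring.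
Qed.

Let qpoch_near_inv m k : near1 m.+1 (qpoch m * u (m + k)).
Proof.
have [h hE] := qpoch_near m k.
(* The inverse x of 1 + y satisfies x = 1 - y x. *)
exists (- h * (qpoch m * u (m + k))).
have e : (1 + mon m.+1 * h) * (qpoch m * u (m + k)) = 1.
  rewrite -hE; transitivity ((qpoch m * u m) * (qpoch (m + k) * u (m + k))).
    by ring.
  by rewrite !qpochK mulr1.
rewrite -{1}[RHS]addr0 -[X in _ = X + _ + _]e; ring.
Qed.

(** The relative error starts at q^(n-j+1); the factor q^(j^2) moves it beyond q^n because j <=
    j^2. *)
Let F_approx n j : (j <= n)%N ->
  eq_upto n (F n j * qpoch n ^+ 2) ((-1) ^+ j * mon (j ^ 2)).
Proof.
move=> jn; have : near1 (n - j).+1 ((qpoch n * u (n - j)) * (qpoch n * u (n + j))).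
  apply: (near1M (k := j)).
    by have := qpoch_near (n - j) j; rewrite subnK.
  by rewrite addSn subnK //; apply: qpoch_near_inv.
move=> [h hE].
have -> : F n j * qpoch n ^+ 2 = (-1) ^+ j * mon (j ^ 2) +
    mon (j ^ 2 + (n - j).+1) * ((-1) ^+ j * h).
  transitivity ((-1) ^+ j * mon (j ^ 2) *
     ((qpoch n * u (n - j)) * (qpoch n * u (n + j)))); first by rewrite /F; ring.
  by rewrite hE monD; ring.
move=> i iN; rewrite seriesD mon_mul leqNgt addnS ltnS (leq_trans iN) ?addr0 //.
nia.
Qed.

Let opp_mon j : opp_subst (mon (j ^ 2)) = (-1) ^+ j * mon (j ^ 2).
Proof.
rewrite -signr_odd; apply/funext=> n.
have -> : ((-1) ^+ odd j * mon (j ^ 2)) n = (-1) ^+ odd j * mon (j ^ 2) n.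
  by case: (odd j); rewrite ?expr1 ?expr0 ?mulN1r ?mul1r.
rewrite /opp_subst /fps_subst_opp /mon; case: eqP => [->|_]; last by rewrite !mulr0.
by rewrite -signr_odd oddX.
Qed.

Let opp_subst_upto n (f g : series R) :
  eq_upto n f g -> eq_upto n (opp_subst f) (opp_subst g).
Proof. by move=> fg i iN; rewrite /opp_subst /fps_subst_opp fg. Qed.

(** The witness [T n * qpoch n ^+ 2] equals (q)_n / (-q)_n exactly, by [T_prod], and agrees with
    phi(-q) up to degree n, by [F_approx]. *)
Lemma gauss_upto n :
  exists2 f, eq_upto n f (opp_subst (phi_series R)) & f * qpoch_plus n = qpoch n.
Proof.
exists (T n * qpoch n ^+ 2); last first.
  by rewrite -[RHS]mul1r -(T_prod n); ring.
move=> i iN; rewrite (opp_subst_upto (@phi_sum R n)) //.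
rewrite /T mulrDl -mulrA mulr_suml seriesD.
rewrite (F_approx (leq0n n)) //.
have -> : opp_subst (1 + 2%:R * \sum_(1 <= j < n.+1) mon (j ^ 2)) =
   1 + 2%:R * \sum_(1 <= j < n.+1) ((-1) ^+ j * mon (j ^ 2)).
  under [X in _ = _ + _ * X]eq_bigr do rewrite -opp_mon.
  apply/funext=> k; rewrite /opp_subst /fps_subst_opp !seriesD mulrDr.
  congr (_ + _); first by case: k => [|k]; rewrite ?mul1r // !series1 mulr0.
  rewrite !mulr_natl !series_muln mulrnAr; congr (_ *+ _).
  by rewrite !series_sum mulr_sumr.
rewrite seriesD expr0 mul1r mon0; congr (_ + _).
rewrite !mulr_natl !series_muln; congr (_ *+ _).
by rewrite !series_sum; apply: eq_big_nat => j /andP[_ jn]; apply: F_approx.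
Qed.
End Gauss.

(** * Overpartitions *)

(** Plain lists instead of codes, so that removing a part does not change the type. *)
Definition overparts (n : nat) : seq (seq (nat * bool)) :=
  [seq overpart_decode b | b <- enum {: overpart_code n} &
     is_overpartition (overpart_decode b) && (weight (overpart_decode b) == n)].

Lemma uniq_overparts n : uniq (overparts n).
Proof.
rewrite map_inj_uniq; last exact: overpart_decode_inj.
by rewrite filter_uniq ?enum_uniq.
Qed.

Lemma mem_overparts n s :
  (s \in overparts n) = is_overpartition s && (weight s == n).
Proof.
apply/mapP/idP => [[b]|/andP[os /eqP ws]]; first by rewrite mem_filter => /andP[h _] ->.
have [b bs] := overpart_code_complete os (eq_leq ws).
by exists b => //; rewrite mem_filter bs os ws eqxx mem_enum.
Qed.

Definition parts_le (m : nat) (s : seq (nat * bool)) := all (fun x => x.1 <= m)%N s.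

(** What may follow an occurrence of the part m. *)
Definition no_over (m : nat) s := parts_le m s && ((m, true) \notin s).

Definition starts (x : nat * bool) (s : seq (nat * bool)) :=
  if s is y :: _ then y == x else false.

Lemma path_parts_le x s : path overpart_next x s -> parts_le x.1 s.
Proof.
elim: s x => //= y s IH x /andP[xy /IH ys].
have yx : (y.1 <= x.1)%N by case/orP: xy => [/ltnW //|/andP[/eqP ->]].
by rewrite yx; apply: sub_all ys => z /leq_trans; apply.
Qed.

(** In an overpartition an overlined m can only be the first occurrence of m, so forbidding it at
    the head forbids it everywhere. *)
Lemma path_no_over m u s :
  path overpart_next (m, u) s = sorted overpart_next s && no_over m s.
Proof.
elim: s u => //= y s IH u; rewrite /no_over /= inE negb_or.
rewrite [overpart_next _ _]/overpart_next /=.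
case: (ltngtP y.1 m) => ym /=; last 1 first.
- case: y ym => y1 w /= ->; rewrite IH /no_over xpair_eqE eqxx /=.
  by case: w; rewrite //= ?andbF // -andbA andbb.
- case: (boolP (path _ y s)) => //= /path_parts_le ys.
  have -> /= : parts_le m s.
    by apply: sub_all ys => z /leq_trans; apply; apply: ltnW.
  have -> /= : (m, true) != y by apply: contraTneq ym => <-; rewrite ltnn.
  by symmetry; apply/negP => /(allP ys) /=; rewrite leqNgt ym.
- by rewrite andbF.
Qed.

Lemma is_overpartition_cons m u s : (0 < m)%N ->
  is_overpartition ((m, u) :: s) = is_overpartition s && no_over m s.
Proof.
by move=> m0; rewrite /is_overpartition /= m0 path_no_over andbAC.
Qed.

Lemma parts_le_head k y s :
  is_overpartition (y :: s) -> parts_le k (y :: s) = (y.1 <= k)%N.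
Proof.
case/andP=> /path_parts_le ys _ /=; case: leqP => //= yk.
by apply: sub_all ys => z /leq_trans; apply.
Qed.

Lemma parts_le_split m s : is_overpartition s ->
  (parts_le m.+1 s = parts_le m s + (starts (m.+1, false) s && parts_le m.+1 s)
     + (starts (m.+1, true) s && parts_le m.+1 s) :> nat)%N.
Proof.
case: s => // -[k w] s os; rewrite !parts_le_head // /starts !xpair_eqE.
rewrite [fst _]/= (leq_eqVlt k m.+1) ltnS.
by case: (eqVneq k m.+1) => [->|_]; rewrite ?ltnn ?addn0 //; case: w {os}.
Qed.

Lemma no_over_split m s : is_overpartition s ->
  (no_over m.+1 s = parts_le m s + (starts (m.+1, false) s && parts_le m.+1 s)
     :> nat)%N.
Proof.
case: s => // -[k w] s os; rewrite /no_over !parts_le_head // /starts.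
rewrite !xpair_eqE [fst _]/= (leq_eqVlt k m.+1) ltnS.
case: (eqVneq k m.+1) => [kE|km].
  subst k; rewrite ltnn inE xpair_eqE eqxx /= negb_or.
  move: os; rewrite is_overpartition_cons // => /andP[_ /andP[_ ->]].
  by case: w.
rewrite addn0; case: leqP => //= k_le; rewrite (_ : _ \notin _) //.
apply: contraL k_le => ms; rewrite -ltnNge.
by have := allP (etrans (parts_le_head k os) (leqnn k)) _ ms.
Qed.

(** Deleting the head is a bijection, and the condition on the rest does not depend on the mark
    u. *)
Lemma count_starts m u n :
  count (fun s => starts (m.+1, u) s && parts_le m.+1 s) (overparts n) =
  if (m < n)%N then count (no_over m.+1) (overparts (n - m.+1)) else 0%N.
Proof.
case: ltnP => [mn|nm].
  symmetry; apply: (@count_perm _ _ (cons (m.+1, u))); rewrite ?uniq_overparts //.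
  - by move=> s t _ _ _ _ [].
  - move=> s; rewrite !mem_overparts => /andP[os /eqP ws] ns.
    have o : is_overpartition ((m.+1, u) :: s).
      by rewrite is_overpartition_cons // os ns.
    rewrite o parts_le_head // leqnn /= eqxx /weight /= -/(weight s) ws.
    by rewrite subnKC // eqxx.
  move=> [|x s]; rewrite // !mem_overparts => /andP[os /eqP ws] /andP[/eqP xE _].
  move: os ws; rewrite xE is_overpartition_cons // => /andP[os ns].
  rewrite /weight /= -/(weight s) => ws; exists s => //.
  by rewrite mem_overparts os ns -ws addKn eqxx.
apply/eqP; rewrite eqn0Ngt -has_count; apply/hasPn => -[|x s] //.
rewrite mem_overparts => /andP[_ /eqP ws]; apply/nandP; left.
by apply: contraL nm => /eqP xE; rewrite -ltnNge -ws xE /weight /= leq_addr.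
Qed.

Lemma count_sum (T : Type) (A : pred T) r : count A r = (\sum_(x <- r) A x)%N.
Proof. by rewrite -sum1_count big_mkcond; apply: eq_bigr => x _; case: (A x). Qed.

Section OverpartSeries.
Variable R : comUnitRingType.

Definition overpart_series : series R := fun n => (size (overparts n))%:R.

Let A m : series R := fun n => (count (parts_le m) (overparts n))%:R.
Let B m : series R := fun n => (count (no_over m) (overparts n))%:R.

Let A_split m : A m.+1 = A m + 2%:R * (mon R m.+1 * B m.+1).
Proof.
apply/funext=> n; rewrite seriesD mulr_natl series_muln mon_mul /A.
have -> : (if (m < n)%N then B m.+1 (n - m.+1)%N else 0) =
    (if (m < n)%N then count (no_over m.+1) (overparts (n - m.+1)) else 0%N)%:R.
  by case: ifP.
rewrite mulr2n -{1}(count_starts _ false) -(count_starts _ true) -!natrD.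
congr _%:R; rewrite !count_sum -!big_split /=.
apply: eq_big_seq => s; rewrite mem_overparts => /andP[os _].
by rewrite addnA; apply: parts_le_split.
Qed.

Let B_split m : B m.+1 = A m + mon R m.+1 * B m.+1.
Proof.
apply/funext=> n; rewrite seriesD mon_mul /A.
have -> : (if (m < n)%N then B m.+1 (n - m.+1)%N else 0) =
    (if (m < n)%N then count (no_over m.+1) (overparts (n - m.+1)) else 0%N)%:R.
  by case: ifP.
rewrite -(count_starts _ false) -!natrD.
congr _%:R; rewrite !count_sum -!big_split /=.
apply: eq_big_seq => s; rewrite mem_overparts => /andP[os _].
exact: no_over_split.
Qed.

Let A0 : A 0 = 1.
Proof.
apply/funext=> n; rewrite series1 /A; congr _%:R.
case: n => [|n]; last first.
  apply/eqP; rewrite [nat_of_bool _]/= eqn0Ngt -has_count; apply/hasPn => -[|[x w] s].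
    by rewrite mem_overparts.
  by rewrite mem_overparts => /andP[/andP[_ /= /andP[x0 _]] _]; rewrite leqNgt x0.
rewrite -[RHS]/(count predT [:: [::] : seq (nat * bool)]).
apply: (@count_perm _ _ id); rewrite ?uniq_overparts //.
  move=> [|[x w] s] //; rewrite mem_overparts => /andP[/andP[_ /= /andP[x0 _]] _].
  by rewrite leqNgt x0.
by move=> s; rewrite inE => /eqP -> _; exists [::] => //; rewrite mem_overparts.
Qed.

(** Solving [B_split] gives B_(m+1) = A_m / (1 - q^(m+1)), and then [A_split] gives A_(m+1) = A_m (1
    + q^(m+1)) / (1 - q^(m+1)). *)
Let A_prod m : A m * qpoch R m = qpoch_plus R m.
Proof.
elim: m => [|m IH].
  by rewrite A0 mul1r /qpoch /qpoch_plus !big_geq.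
rewrite qpochS /qpoch_plus big_nat_recr //= -/(qpoch_plus R m) -IH A_split.
have -> : A m = B m.+1 - mon R m.+1 * B m.+1 by rewrite {1}B_split addrK.
ring.
Qed.

Let series_upto m : eq_upto m overpart_series (A m).
Proof.
move=> n nm; rewrite /overpart_series /A; congr _%:R; symmetry; apply/eqP.
rewrite -all_count; apply/allP => s; rewrite mem_overparts => /andP[_ /eqP ws].
apply/allP => x xs; apply: leq_trans nm; rewrite -ws /weight.
by rewrite (perm_sumn (perm_map _ (perm_to_rem xs))) /= leq_addr.
Qed.

(** Up to degree n the two factors are (-q)_n / (q)_n and (q)_n / (-q)_n. *)
Lemma overpart_phi : overpart_series * opp_subst (phi_series R) = 1.
Proof.
apply/funext=> n; have [f fphi fq] := gauss_upto R n.
have fphi' : eq_upto n (opp_subst (phi_series R)) f by move=> i /fphi.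
rewrite (eq_uptoM (@series_upto n) fphi' (leqnn n)).
suff -> : A n * f = 1 by [].
transitivity (A n * qpoch R n * f * qpoch_inv R n).
  by transitivity (A n * f * (qpoch R n * qpoch_inv R n)); [rewrite qpochK mulr1|ring].
by rewrite A_prod [_ * f]mulrC fq qpochK.
Qed.
End OverpartSeries.

(** The members of a triple all live in [overpart_code n] whatever their weights, so one code type
    has to serve every weight up to n. *)
Lemma overpart_series_code (R : comUnitRingType) n :
  eq_upto n (overpart_series R)
    (\sum_(b : overpart_code n | is_overpartition (overpart_decode b))
       mon R (weight (overpart_decode b))).
Proof.
move=> i iN; rewrite sum_mon_coef /overpart_series; congr _%:R.
rewrite -count_predT; symmetry.
apply: (@count_perm _ _ (@overpart_decode n)); rewrite ?index_enum_uniq ?uniq_overparts //.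
- by move=> b c _ _ _ _ /overpart_decode_inj.
- by move=> b _ /=; rewrite andbT mem_overparts.
move=> s; rewrite mem_overparts => /andP[os /eqP ws] _.
have [|b bs] := overpart_code_complete (n := n) os; first by rewrite ws.
by exists b => //; rewrite mem_index_enum bs os ws eqxx.
Qed.

Lemma pbar3_series (R : comUnitRingType) :
  (fun n => (pbar3 n)%:R : R) = overpart_series R ^+ 3 :> series R.
Proof.
apply/funext=> n; have O := @overpart_series_code R n.
rewrite !exprSr expr0 mul1r (eq_uptoM (eq_uptoM O O) O (leqnn n)).
rewrite !sum_mon_mul sum_mon_coef; congr _%:R.
rewrite /pbar3 cardE /enum_mem size_filter -enumT.
apply: (@count_perm _ _ id); rewrite ?enum_uniq //.
- by rewrite !uniq_pairs // index_enum_uniq.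
- move=> [[a b] c] _ /=; rewrite inE /= => /and4P[-> -> -> ->].
  by rewrite !mem_pairs !mem_index_enum.
move=> [[a b] c] _ /= h; exists (a, b, c) => //.
by rewrite mem_enum 2!inE /=; move: h; rewrite -!andbA.
Qed.

(** * Residue rings and the induction on alpha *)

Lemma intr_Zp_eq d (x y : int) : (1 < d)%N ->
  x%:~R = y%:~R :> 'Z_d -> (d %| x - y)%Z.
Proof.
move=> d1 xy; have : (x - y)%:~R = 0 :> 'Z_d by rewrite rmorphB /= xy subrr.
move: (x - y) => z z0; rewrite dvdzE absz_nat.
have {z0} : `|z|%N%:R = 0 :> 'Z_d.
  by case: z z0 => k //=; rewrite NegzE mulrNz => /eqP; rewrite oppr_eq0 => /eqP.
by move/(congr1 val); rewrite /= val_Zp_nat // /dvdn => ->.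
Qed.

Lemma natr_Zp d : (1 < d)%N -> d%:R = 0 :> 'Z_d.
Proof. by move=> d1; apply: val_inj; rewrite /= val_Zp_nat // modnn. Qed.

Section Iterate.
Variables (R : comUnitRingType) (P p v : series R).
Hypothesis base : sect3 (sect3 P) * p ^+ 7 = v ^+ 4.
Hypothesis even : forall f, f * p ^+ 7 = v ^+ 4 -> sect3 f * p ^+ 8 = v ^+ 5.
Hypothesis odd : forall f, f * p ^+ 8 = v ^+ 5 -> sect3 f * p ^+ 7 = v ^+ 4.

Lemma iter_sect3 k :
  iter (2 * k.+1) (@sect3 R) P * p ^+ 7 = v ^+ 4 /\
  iter (2 * k.+1 + 1) (@sect3 R) P * p ^+ 8 = v ^+ 5.
Proof.
have e : iter (2 * k.+1) (@sect3 R) P * p ^+ 7 = v ^+ 4.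
  elim: k => [|k IH]; first exact: base.
  by rewrite mulnS; apply/odd/even.
by split=> //; rewrite addn1; apply: even.
Qed.
End Iterate.

Lemma iter_sect3E (R : comUnitRingType) k (f : series R) n :
  iter k (@sect3 R) f n = f (3 ^ k * n)%N.
Proof.
by elim: k n => [|k IH] n; rewrite ?mul1n //= /sect3 IH expnSr mulnA.
Qed.

(** * The congruences *)

Definition signed_pbar3 : series int := opp_subst (fun n => (pbar3 n)%:Z).

(** As 3^k is odd, the signs of q^n and q^(3^k n) under q -> -q agree, so the sign change commutes
    with U. *)
Lemma signed_pbar3E k :
  fps_subst_opp (fun n => (pbar3 (3 ^ k * n)%N)%:Z) = iter k (@sect3 int) signed_pbar3.
Proof.
apply/funext=> n; rewrite iter_sect3E /signed_pbar3 /opp_subst /fps_subst_opp.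
by congr (_ * _); rewrite -signr_odd -[RHS]signr_odd oddM oddX orbT.
Qed.

Lemma signed_pbar3_phi : signed_pbar3 * (phi : series int) ^+ 3 = 1.
Proof.
have pE : phi_series int = phi by apply/funext=> n; rewrite /phi_series /map_series intz.
have -> : signed_pbar3 = opp_subst (overpart_series int) ^+ 3.
  by rewrite -opp_substX -pbar3_series; congr opp_subst; apply/funext=> n; rewrite natz.
by rewrite -exprMn -pE -[phi_series _]opp_substK -opp_substM overpart_phi opp_subst1 expr1n.
Qed.

Section Quotient.
Variable R : comUnitRingType.
Let P := map_series R signed_pbar3.

Let P_phi : P * phi_series R ^+ 3 = 1.
Proof. by rewrite -map_seriesX -map_seriesM signed_pbar3_phi map_series1. Qed.

Lemma iter_sect3_phi k : 8%:R = 0 :> R \/ 9%:R = 0 :> R ->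
  iter (2 * k.+1) (@sect3 R) P * phi_series R ^+ 7 = cube_subst (phi_series R) ^+ 4 /\
  iter (2 * k.+1 + 1) (@sect3 R) P * phi_series R ^+ 8 = cube_subst (phi_series R) ^+ 5.
Proof.
have pE := phi_dissection R; have supp := @theta_supp R.
have quartic := phi_quartic R.
case=> [R8|R9]; apply: iter_sect3.
- have [s sE] := phi_odd R; exact: sect3_sect3_eight R8 pE supp sE P_phi.
- have [s sE] := phi_odd R; exact: sect3_even_eight R8 pE supp sE.
- have [s sE] := phi_odd R; exact: sect3_odd_eight R8 sE.
- exact: sect3_sect3_nine R9 pE supp quartic P_phi.
- exact: sect3_even_nine R9 pE supp quartic P_phi.
- exact: sect3_odd_nine R9 pE supp quartic P_phi.
Qed.

(** The quotient is formed over the integers, where phi has constant term 1. Over R, phi is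
    invertible with inverse P phi^2, so the equation cleared of denominators determines its
    reduction. *)
Let map_quotient i j (f : series int) :
  map_series R f * phi_series R ^+ j = cube_subst (phi_series R) ^+ i ->
  map_series R f =
  map_series R (fps_div (fps_exp (fps_subst_pow 3 phi) i) (fps_exp phi j)).
Proof.
have phij0 : (fps_exp phi j) 0%N \is a GRing.unit.
  suff -> : (fps_exp phi j) 0%N = 1 by exact: unitr1.
  elim: j {f} => // j IH; rewrite /fps_exp iterS -/(fps_exp phi j).
  by rewrite /fps_mul big_ord1 phi0 IH.
set Q := fps_div _ _ => fE.
have QE : map_series R Q * phi_series R ^+ j = cube_subst (phi_series R) ^+ i.
  rewrite -map_seriesX -map_seriesM -fps_expE fps_divK // fps_expE.
  by rewrite map_seriesX map_series_cube.
have pj : phi_series R ^+ j * (P * phi_series R ^+ 2) ^+ j = 1.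
  by rewrite -exprMn mulrCA -exprS P_phi expr1n.
by rewrite -[LHS]mulr1 -pj mulrA fE -QE -mulrA pj mulr1.
Qed.

Lemma map_pbar3 k : 8%:R = 0 :> R \/ 9%:R = 0 :> R ->
  map_series R (fps_subst_opp (fun n => (pbar3 (3 ^ (2 * k.+1) * n)%N)%:Z)) =
  map_series R (fps_div (fps_exp (fps_subst_pow 3 phi) 4) (fps_exp phi 7)) /\
  map_series R (fps_subst_opp (fun n => (pbar3 (3 ^ (2 * k.+1 + 1) * n)%N)%:Z)) =
  map_series R (fps_div (fps_exp (fps_subst_pow 3 phi) 5) (fps_exp phi 8)).
Proof.
have iterM l : map_series R (iter l (@sect3 int) signed_pbar3) = iter l (@sect3 R) P.
  by elim: l => //= l <-.
move=> /(iter_sect3_phi k)[e o]; rewrite !signed_pbar3E.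
by split; apply: map_quotient; rewrite iterM.
Qed.
End Quotient.

(** The moduli 8 and 9 are coprime with product 72. *)
Lemma fps_eqmod_map (f g : fps int) :
  map_series 'Z_8 f = map_series 'Z_8 g -> map_series 'Z_9 f = map_series 'Z_9 g ->
  fps_eqmod (9 * 2 ^+ 3) f g.
Proof.
move=> f8 f9 n; apply/eqP; rewrite eqz_mod_dvd.
have := intr_Zp_eq (isT : (1 < 8)%N) (congr1 (fun h => h n) f8).
have := intr_Zp_eq (isT : (1 < 9)%N) (congr1 (fun h => h n) f9).
rewrite (_ : 9 * 2 ^+ 3 = 72) //; lia.
Qed.

Theorem theorem3p6 (alpha : nat) (alpha_ge1 : (1 <= alpha)%N) :
  fps_eqmod (9 * 2 ^+ 3)
    (fps_subst_opp (fun n => (pbar3 (3 ^ (2 * alpha) * n)%N)%:Z))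
    (fps_div (fps_exp (fps_subst_pow 3 phi) 4) (fps_exp phi 7))
  /\
  fps_eqmod (9 * 2 ^+ 3)
    (fps_subst_opp (fun n => (pbar3 (3 ^ (2 * alpha + 1) * n)%N)%:Z))
    (fps_div (fps_exp (fps_subst_pow 3 phi) 5) (fps_exp phi 8)).
Proof.
case: alpha alpha_ge1 => // k _.
have [e8 o8] := @map_pbar3 'Z_8 k (or_introl (@natr_Zp 8 isT)).
have [e9 o9] := @map_pbar3 'Z_9 k (or_intror (@natr_Zp 9 isT)).
by split; apply: fps_eqmod_map.
Qed.
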